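(* Let $A=(a_{ij})\in\mathbb{B}^{n\times n}$, $\lambda\in\mathbb{B}$, and let $K,L\subseteq N=\{1,\dots,n\}$ satisfy $K\cup L=N$ and $K\cap L=\emptyset$. With $L_2,\tilde L,\tilde N,A',b',I_0,C_j$ as defined in the context, the following are equivalent: (i) a $(K,L)$-eigenvector of $A$ associated with $\lambda$ exists; (ii) the equation $$\lambda A_{L_2K}(A_{KK})^*A_{KL}\mathbf{1}_L\oplus A_{L_2K}(A_{KK})^*A_{K\tilde L}z_{\tilde L}\oplus A_{L_2K}(A_{KK})^*_{\lambda}z_K=\lambda\mathbf{1}_{L_2}$$ is solvable in $z_{\tilde L}\in\mathbb{B}^{\tilde L}$, $z_K\in\mathbb{B}^{K}$; (iii) $I_0=\bigcup_{j\in\tilde N}C_j$. In this case, $x=(x_K\ x_L)^T\in\mathbb{B}^n$ is a $(K,L)$-eigenvector of $A$ with eigenvalue $\lambda$ if and only if $x_K$ and $x_L$ can be expressed as $$x_L=\lambda\mathbf{1}_L\oplus v_{\tilde L},$$ $$x_K=\lambda(A_{KK})^*A_{KL}\mathbf{1}_L\oplus(A_{KK})^*A_{K\tilde L}v_{\tilde L}\oplus(A_{KK})^*_{\lambda}(z^W_K\oplus v_K),$$ for some $v_K\in\mathbb{B}^{K}$, some $v_{\tilde L}\in\mathbb{B}^{\tilde L}$, and some $W\subseteq\tilde N$ such that $\{C_j: j\in W\}$ is a minimal covering of $I_0$, where $z^W=(z^W_{\tilde L}\ z^W_K)$ is the minimal solution, corresponding to $W$, of the equation $\lambda A_{L_2K}(A_{KK})^*A_{KL}\mathbf{1}_L\oplus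 A_{L_2K}(A_{KK})^*A_{K\tilde L}z_{\tilde L}\oplus A_{L_2K}(A_{KK})^*_{\lambda}z_K=\lambda\mathbf{1}_{L_2}$ in the unknowns $z_{\tilde L}$, $z_K$.
   Context: Max-min algebra: $\mathbb{B}=[0,1]$ with $a\oplus b=\max(a,b)$ and $a\otimes b=ab=\min(a,b)$, extended to matrices and vectors in the usual way ($(A\oplus B)_{ij}=a_{ij}\oplus b_{ij}$, $(AB)_{ij}=\bigoplus_k a_{ik}b_{kj}$, $(\lambda x)_i=\lambda x_i$); an empty sum is $0$ and conditions indexed by an empty set hold vacuously. Inequalities between vectors are componentwise. $\mathbf 1_L$ is the all-ones vector indexed by $L$. For index sets $P,Q\subseteq N$, $A_{PQ}$ is the submatrix of $A$ with rows in $P$ and columns in $Q$, and $x_P$ is the subvector of $x$ indexed by $P$. For a square matrix $M$ over $\mathbb{B}$: $M^+=M\oplus M^2\oplus M^3\oplus\cdots$ and $M^*=I\oplus M\oplus M^2\oplus\cdots$ (these series stabilize after finitely many terms), where $I$ has $1$ on the diagonal and $0$ elsewhere; $M^*_\lambda$ is the matrix whose $i$th column is $\lambda\,(M^+)_{ii}\,(M^* )_{\cdot i}$. $(A_{KK})^*_\lambda$ is this matrix for $M=A_{KK}$. A $(K,L)$-eigenvector of $A$ associated with $\lambda$ is a vector $x\in\mathbb{B}^n$ with $Ax=\lambda x$, $x_i\le\lambda$ for all $i\in K$ and $x_i\ge\lambda$ for all $i\in L$ (the zero vector is not excluded). Define $L_1=\{i\in L:\bigoplus_{j\in L}a_{ij}\ge\lambda\}$,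 $L_2=\{i\in L:\bigoplus_{j\in L}a_{ij}<\lambda\}$, $L^{>\lambda,L_1}=\{k\in L:\max_{i\in L_1}a_{ik}>\lambda\}$, $L^{>\lambda,K}=\{\ell\in L:\max_{k\in K}((A_{KK})^*A_{KL})_{k\ell}>\lambda\}$, $L'=L^{>\lambda,L_1}\cup L^{>\lambda,K}$, $\tilde L=L\setminus L'$, $\tilde N=\tilde L\cup K$. A vector $v_{\tilde L}\in\mathbb{B}^{\tilde L}$ appearing in a sum with a vector indexed by $L$ is extended by $0$ on $L\setminus\tilde L$. Let $A'=(A_{L_2K}(A_{KK})^*A_{K\tilde L},\ A_{L_2K}(A_{KK})^*_\lambda)$ (rows indexed by $L_2$, columns by $\tilde N=\tilde L\cup K$) and $b'=\lambda A_{L_2K}(A_{KK})^*A_{KL}\mathbf{1}_L$. The equation in (ii) is $A'z'\oplus b'=\lambda\mathbf 1_{L_2}$ with $z'=(z_{\tilde L}\ z_K)^T$. Let $I_0=\{i\in L_2: A_{iK}(A_{KK})^*A_{KL}\mathbf{1}_L<\lambda\}$, and $C_j=\{i\in I_0:(A')_{ij}=\lambda\}$ for $j\in\tilde N$. For $W\subseteq\tilde N$, $\{C_j:j\in W\}$ is a covering of $I_0$ if $\bigcup_{j\in W}C_j=I_0$, and a minimal covering if moreover $\bigcup_{j\in V}C_j\ne I_0$ for every proper subset $V\subsetneq W$. The minimal solution corresponding to $W$ is $z^W\in\mathbb{B}^{\tilde N}$ with $z^W_j=\lambda$ for $j\in W$ and $z^W_j=0$ otherwise; $z^W_K$ and $z^W_{\tilde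 L}$ are its subvectors. *)

(* Defs.v *)
From HB Require Import structures.
From mathcomp Require Import all_boot all_order all_algebra.
From mathcomp Require Import reals.

Set Implicit Arguments.
Unset Strict Implicit.
Unset Printing Implicit Defensive.

Import Order.TTheory GRing.Theory Num.Theory.
Local Open Scope ring_scope.

(* The max-min algebra B = [0, 1] is a commutative semiring with addition max
   and multiplication min, so that [+], [\sum], [*m], [*:] and [^+] on matrices
   over it are the max-min operations; it carries the order inherited from R. *)
Record maxmin (R : realType) :=
  MaxMin { mmval :> R; mmvalP : (0 <= mmval) && (mmval <= 1) }.

HB.instance Definition _ (R : realType) := [isSub for @mmval R].
HB.instance Definition _ (R : realType) := [Choice of maxmin R by <:].
HB.instance Definition _ (R : realType) :=
  [SubChoice_isSubOrder of maxmin R by <: with ring_display].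

Section MaxMinSemiRing.
Variable R : realType.
Implicit Types a b c : maxmin R.

Fact mm0_subproof : (0 <= (0 : R)) && ((0 : R) <= 1).
Proof. by rewrite lexx ler01. Qed.

Fact mm1_subproof : (0 <= (1 : R)) && ((1 : R) <= 1).
Proof. by rewrite lexx ler01. Qed.

Definition mm0 : maxmin R := MaxMin mm0_subproof.
Definition mm1 : maxmin R := MaxMin mm1_subproof.
Definition mmadd a b : maxmin R := Order.max a b.
Definition mmmul a b : maxmin R := Order.min a b.

Lemma mm0_le a : mm0 <= a.
Proof. by case: a => a aP; case/andP: (aP). Qed.

Lemma le_mm1 a : a <= mm1.
Proof. by case: a => a aP; case/andP: (aP). Qed.

Fact mmaddA : associative mmadd. Proof. exact: maxA. Qed.
Fact mmaddC : commutative mmadd. Proof. exact: maxC. Qed.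
Fact mmadd0 : left_id mm0 mmadd.
Proof. by move=> a; apply/max_idPr/mm0_le. Qed.
Fact mmmulA : associative mmmul. Proof. exact: minA. Qed.
Fact mmmulC : commutative mmmul. Proof. exact: minC. Qed.
Fact mmmul1 : left_id mm1 mmmul.
Proof. by move=> a; apply/min_idPr/le_mm1. Qed.
Fact mmmulDl : left_distributive mmmul mmadd. Proof. exact: min_maxl. Qed.
Fact mmmul0 : left_zero mm0 mmmul.
Proof. by move=> a; apply/min_idPl/mm0_le. Qed.
Fact mm1_neq0 : mm1 != mm0. Proof. by rewrite -val_eqE /= oner_neq0. Qed.

HB.instance Definition _ :=
  GRing.isNmodule.Build (maxmin R) mmaddA mmaddC mmadd0.
HB.instance Definition _ := GRing.Nmodule_isComNzSemiRing.Build (maxmin R)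
  mmmulA mmmulC mmmul1 mmmulDl mmmul0 mm1_neq0.

Lemma mmaddE a b : a + b = Order.max a b. Proof. by []. Qed.
Lemma mmmulE a b : a * b = Order.min a b. Proof. by []. Qed.
Lemma mm_ge0 a : (0 : maxmin R) <= a. Proof. exact: mm0_le. Qed.
Lemma mm_le1 a : a <= (1 : maxmin R). Proof. exact: le_mm1. Qed.

End MaxMinSemiRing.

(* The series M + M^2 + ... and I + M + M^2 + ... are stationary from the term
   of index m on, where m is the order of M (mxplus_stable and mxstar_stable
   below), so they are written as finite sums. *)
Definition mxplus (R : realType) (m : nat) (M : 'M[maxmin R]_m) : 'M_m :=
  \sum_(1 <= k < m.+1) M ^+ k.

Definition mxstar (R : realType) (m : nat) (M : 'M[maxmin R]_m) : 'M_m :=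
  \sum_(0 <= k < m.+1) M ^+ k.

Section Stabilization.
Variable R : realType.
Implicit Types a b c : maxmin R.

Lemma le_mmsum (I : eqType) (r : seq I) (F : I -> maxmin R) i :
  i \in r -> F i <= \sum_(j <- r) F j.
Proof.
elim: r => // j r IHr; rewrite inE big_cons mmaddE le_max.
by case/orP => [/eqP->|/IHr->]; rewrite ?lexx ?orbT.
Qed.

Lemma mmsum_le (I : eqType) (r : seq I) (F : I -> maxmin R) c :
  (forall i, i \in r -> F i <= c) -> \sum_(j <- r) F j <= c.
Proof.
move=> Fc; rewrite big_seq.
by elim/big_ind: _ => [|x y xc yc|]; rewrite ?mm_ge0 ?mmaddE ?ge_max ?xc ?yc.
Qed.

Lemma mmsum_ge (I : eqType) (r : seq I) (F : I -> maxmin R) t :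
  (0 : maxmin R) < t -> t <= \sum_(j <- r) F j -> exists2 i, i \in r & t <= F i.
Proof.
move=> t0; elim: r => [|j r IHr]; first by rewrite big_nil leNgt t0.
rewrite big_cons mmaddE le_max => /orP[tj|/IHr[i ir ti]].
  by exists j => //; rewrite mem_head.
by exists i => //; rewrite inE ir orbT.
Qed.

Lemma mxpow_path m (M : 'M[maxmin R]_m) (t : maxmin R) k i j :
  (0 : maxmin R) < t ->
  t <= (M ^+ k) i j <->
  exists p, [/\ path (fun x y => t <= M x y) i p, last i p = j & size p = k].
Proof.
move=> t0; elim: k i => [|k IHk] i.
  rewrite expr0 mxE; split=> [|[p [_ <- /size0nil->]]]; last first.
    by rewrite eqxx mm_le1.
  case: eqP => [-> _|_ /=]; first by exists [::].
  by rewrite leNgt t0.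
rewrite exprS mxE; split=> [/(mmsum_ge t0)[l _]|].
  rewrite mmmulE le_min => /andP[til /IHk[p [ep lp sp]]].
  by exists (l :: p); rewrite /= til ep lp sp.
case=> -[|l p] [] //= /andP[til ep] lp [sp].
apply: le_trans (le_mmsum _ (mem_index_enum l)).
by rewrite mmmulE le_min til /=; apply/IHk; exists p.
Qed.

Lemma mxpow_shorten m (M : 'M[maxmin R]_m) k i j :
  exists2 h, (h < m)%N & (M ^+ k) i j <= (M ^+ h) i j.
Proof.
have [t0|] := ltP (0 : maxmin R) ((M ^+ k) i j); last first.
  move=> z; exists 0%N; first by case: m M i j z => // M [].
  by rewrite (le_trans z) ?mm_ge0.
have [/(_ (lexx _))[p [ep lp _]] _] := mxpow_path M k i j t0.
case/shortenP: ep lp => p' ep' up' _ lp; exists (size p').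
  by have := max_card (mem (i :: p')); rewrite card_ord (card_uniqP up').
by apply: (proj2 (mxpow_path M _ _ _ t0)); exists p'.
Qed.

Lemma mxpowS_shorten m (M : 'M[maxmin R]_m) k i j :
  exists2 h, (h < m)%N & (M ^+ k.+1) i j <= (M ^+ h.+1) i j.
Proof.
have [t0|] := ltP (0 : maxmin R) ((M ^+ k.+1) i j); last first.
  move=> z; exists 0%N; first by case: m M i j z => // M [].
  by rewrite (le_trans z) ?mm_ge0.
have := lexx ((M ^+ k.+1) i j); rewrite {2}exprS mxE => /(mmsum_ge t0)[l _].
rewrite mmmulE le_min => /andP[til tlj].
have [h hm le_h] := mxpow_shorten M k l j; exists h => //.
rewrite [M ^+ h.+1]exprS [leRHS]mxE.
apply: le_trans (le_mmsum _ (mem_index_enum l)).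
by rewrite mmmulE le_min til (le_trans tlj).
Qed.

Lemma mxplus_stable m (M : 'M[maxmin R]_m) h :
  (m <= h)%N -> \sum_(1 <= k < h.+1) M ^+ k = mxplus M.
Proof.
move=> mh; apply/matrixP => i j; rewrite !summxE; apply: le_anti.
apply/andP; split; apply: mmsum_le => -[|k];
  rewrite mem_index_iota // !ltnS /= => km.
  have [l lm le_l] := mxpowS_shorten M k i j; apply: le_trans le_l _.
  apply: (le_mmsum (fun k => (M ^+ k) i j)).
  by rewrite mem_index_iota !ltnS.
apply: (le_mmsum (fun k => (M ^+ k) i j)).
by rewrite mem_index_iota !ltnS (leq_trans km).
Qed.

Lemma mxstar_stable m (M : 'M[maxmin R]_m) h :
  (m <= h)%N -> \sum_(0 <= k < h.+1) M ^+ k = mxstar M.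
Proof.
move=> mh; rewrite /mxstar [LHS]big_ltn // [RHS]big_ltn //.
by congr (_ + _); apply: mxplus_stable.
Qed.

End Stabilization.

Definition mxstar_scaled (R : realType) (m : nat) (lambda : maxmin R)
    (M : 'M[maxmin R]_m) : 'M_m :=
  \matrix_(i, j) (lambda * mxplus M j j * mxstar M i j).

(* Rows and columns of A_{PQ} (and entries of x_P) are numbered by 'I_#|P| and
   'I_#|Q| through enum_val. *)
Definition submat (R : realType) (n : nat) (A : 'M[maxmin R]_n)
    (P Q : {set 'I_n}) : 'M[maxmin R]_(#|P|, #|Q|) :=
  \matrix_(i, j) A (enum_val i) (enum_val j).

Definition subvec (R : realType) (n : nat) (x : 'cV[maxmin R]_n)
    (P : {set 'I_n}) : 'cV[maxmin R]_#|P| :=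
  \col_i x (enum_val i) 0.

(* Extension by 0 of a vector indexed by Q to one indexed by P: the sum has at
   most one term. *)
Definition extend0 (R : realType) (n : nat) (P Q : {set 'I_n})
    (v : 'cV[maxmin R]_#|Q|) : 'cV[maxmin R]_#|P| :=
  \col_i \sum_(j < #|Q| | enum_val j == enum_val i) v j 0.

Definition ones (R : realType) (m : nat) : 'cV[maxmin R]_m := const_mx 1.
Arguments ones {R m}.

Definition KL_eigenvector (R : realType) (n : nat) (A : 'M[maxmin R]_n)
    (lambda : maxmin R) (K L : {set 'I_n}) (x : 'cV[maxmin R]_n) : Prop :=
  [/\ A *m x = lambda *: x,
      forall i, i \in K -> x i 0 <= lambda
    & forall i, i \in L -> lambda <= x i 0].

Section KLData.
Variables (R : realType) (n : nat) (A : 'M[maxmin R]_n) (lambda : maxmin R).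
Variables (K L : {set 'I_n}).

Definition idxL1 : {set 'I_n} := [set i in L | lambda <= \sum_(j in L) A i j].
Definition idxL2 : {set 'I_n} := [set i in L | \sum_(j in L) A i j < lambda].

Definition idxLgtL1 : {set 'I_n} :=
  [set k in L | lambda < \sum_(i in idxL1) A i k].

Definition idxLgtK : {set 'I_n} :=
  [set enum_val l | l : 'I_#|L|
     & lambda < \sum_k (mxstar (submat A K K) *m submat A K L) k l].

Definition idxL' : {set 'I_n} := idxLgtL1 :|: idxLgtK.
Definition idxLt : {set 'I_n} := L :\: idxL'.

(* When K and L are disjoint, so are idxLt and K, and the columns of mxA',
   indexed by idxLt :|: K, are numbered by 'I_(#|idxLt| + #|K|), those of idxLt
   coming first. *)
Definition mxA' : 'M[maxmin R]_(#|idxL2|, #|idxLt| + #|K|) :=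
  row_mx (submat A idxL2 K *m mxstar (submat A K K) *m submat A K idxLt)
         (submat A idxL2 K *m mxstar_scaled lambda (submat A K K)).

Definition idxI0 : {set 'I_#|idxL2|} :=
  [set i | (submat A idxL2 K *m mxstar (submat A K K)
            *m submat A K L *m ones) i 0 < lambda].

Definition cover_set (j : 'I_(#|idxLt| + #|K|)) : {set 'I_#|idxL2|} :=
  [set i in idxI0 | mxA' i j == lambda].

Definition covering (W : {set 'I_(#|idxLt| + #|K|)}) : Prop :=
  \bigcup_(j in W) cover_set j = idxI0.

Definition minimal_covering (W : {set 'I_(#|idxLt| + #|K|)}) : Prop :=
  covering W /\
  forall V : {set 'I_(#|idxLt| + #|K|)}, V \proper W -> ~ covering V.

Definition zW (W : {set 'I_(#|idxLt| + #|K|)}) :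
    'cV[maxmin R]_(#|idxLt| + #|K|) :=
  \col_j (if j \in W then lambda else 0).

Definition zW_K (W : {set 'I_(#|idxLt| + #|K|)}) : 'cV[maxmin R]_#|K| :=
  dsubmx (zW W).

End KLData.

Arguments cover_set {R n} A lambda K L j.
Arguments covering {R n} A lambda K L W.
Arguments minimal_covering {R n} A lambda K L W.
Arguments zW {R n} A lambda K L W.
Arguments zW_K {R n} A lambda K L W.

(* Main.v *)
Require Import Defs.
From mathcomp Require Import all_boot all_order all_algebra.
From mathcomp Require Import reals.

Set Implicit Arguments.
Unset Strict Implicit.
Unset Printing Implicit Defensive.

Import Order.TTheory GRing.Theory Num.Theory.
Local Open Scope ring_scope.

(** Write [x] in blocks along [K] and [L]. On [K] an eigenvector satisfies
    [x_K <= lambda], so [lambda x_K = x_K] and the rows of [A x = lambda x] in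
    [K] form a Bellman equation [x_K = A_KK x_K + A_KL x_L]. Its solutions below
    [lambda] are of the form [star (A_KL x_L) + star_l v]: any such vector is a
    solution because [A_KK star_l = star_l] ([mul_mxstar_scaled]), and
    conversely iterating the equation leaves a remainder carried by walks so
    long that they close a cycle, which is what [star_l] records
    ([bellman_decomposition]).

    The rows in [L] demand that [A_LK x_K + A_LL x_L = lambda]. An entry of
    [A_LL] or of [star A_KL] above [lambda] forces the entry of [x_L] at its
    column down to [lambda]; this is why [x_L] can exceed [lambda] only on the
    subset [Lt]. Once this is granted, a row in [L1] is satisfied by its part in
    [L], while a row in [L2] has a part in [L] strictly below [lambda], so that
    [A_{L2 K} x_K = lambda] is needed ([rows_L_equiv]). Substituting the form of
    [x_K] turns this into a linear equation [lambda c + B z = lambda] in the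
    parameters [z = (v_Lt, v_K)].

    As the entries of [B] are at most [lambda], such an equation says that each
    row with [c i < lambda] has a [j] with [B i j = lambda] and
    [z j >= lambda]: the set of the [j] with [z j >= lambda] is a covering
    ([scaled_equation_covering]). Solvability therefore means that all the
    columns together cover.

    An eigenvector [x] is its own parameter, [z = (x_Lt, x_K)]. A minimal
    covering [W] inside the one given by this [z] has [zW_K W <= x_K], so adding
    [zW_K W] to [v_K = x_K] changes nothing. Conversely, adding [zW_K W] to any
    [v_K] solves the equation, although [v_Lt] is left alone, because the
    columns from [Lt] cover no row at all ([mxA'_Lt_lt]). *)

(** * Order and sums in the max-min semiring *)

Section Sums.
Variable R : realType.
Implicit Types a b c t : maxmin R.

Lemma mmadd_idPr a b : a <= b -> a + b = b.
Proof. by move=> ab; rewrite mmaddE; apply/max_idPr. Qed.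

Lemma mmmul_idPl a b : a <= b -> a * b = a.
Proof. by move=> ab; rewrite mmmulE; apply/min_idPl. Qed.

Lemma mmmul_idPr a b : b <= a -> a * b = b.
Proof. by move=> ab; rewrite mmmulE; apply/min_idPr. Qed.

Lemma mmmul_lel a b c : a <= c -> a * b <= c.
Proof. by move=> ac; rewrite mmmulE ge_min ac. Qed.

Lemma mmmul_ler a b c : b <= c -> a * b <= c.
Proof. by move=> bc; rewrite mmmulE ge_min bc orbT. Qed.

Lemma mmmul_ge a b t : t <= a -> t <= b -> t <= a * b.
Proof. by move=> ta tb; rewrite mmmulE le_min ta. Qed.

Lemma mmmul_ge_split a b t : t <= a * b -> t <= a /\ t <= b.
Proof. by rewrite mmmulE le_min => /andP. Qed.

Lemma mmadd_le a b c : a <= c -> b <= c -> a + b <= c.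
Proof. by move=> ac bc; rewrite mmaddE ge_max ac. Qed.

Lemma mmadd_gel a b t : t <= a -> t <= a + b.
Proof. by move=> ta; rewrite mmaddE le_max ta. Qed.

Lemma mmadd_ger a b t : t <= b -> t <= a + b.
Proof. by move=> tb; rewrite mmaddE le_max tb orbT. Qed.

Section Cond.
Variables (I : finType) (P : pred I).
Implicit Types F G : I -> maxmin R.

Lemma le_mmsum_cond F i : P i -> F i <= \sum_(j | P j) F j.
Proof. by move=> Pi; rewrite (bigD1 i) //=; apply: mmadd_gel. Qed.

Lemma mmsum_cond_le F c :
  (forall i, P i -> F i <= c) -> \sum_(j | P j) F j <= c.
Proof.
move=> Fc; elim/big_ind: _ => // [|a b]; first exact: mm_ge0.
exact: mmadd_le.
Qed.

Lemma mmsum_cond_gt F c :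
  c < \sum_(j | P j) F j -> exists2 i, P i & c < F i.
Proof.
move=> cF; case: (pickP (fun i => P i && (c < F i))) => [i /andP[]|no].
  by exists i.
suff: \sum_(j | P j) F j <= c by rewrite leNgt cF.
by apply: mmsum_cond_le => i Pi; have := no i; rewrite Pi leNgt /= => ->.
Qed.

Lemma mmsum_cond_mono F G :
  (forall i, P i -> F i <= G i) -> \sum_(j | P j) F j <= \sum_(j | P j) G j.
Proof.
move=> FG; apply: mmsum_cond_le => i Pi.
exact: le_trans (FG i Pi) (le_mmsum_cond _ Pi).
Qed.

End Cond.

Section Product.
Variables (m p q : nat) (A : 'M[maxmin R]_(m, p)) (B : 'M[maxmin R]_(p, q)).

Lemma mulmx_le i j c : (forall k, A i k * B k j <= c) -> (A *m B) i j <= c.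
Proof. by move=> le_c; rewrite mxE; apply: mmsum_cond_le => k _. Qed.

Lemma le_mulmx i j k t : t <= A i k -> t <= B k j -> t <= (A *m B) i j.
Proof.
move=> tA tB; apply: le_trans (mmmul_ge tA tB) _.
by rewrite mxE; apply: (le_mmsum_cond (fun k => A i k * B k j)).
Qed.

Lemma mulmx_ge i j t :
  (0 : maxmin R) < t -> t <= (A *m B) i j -> exists2 k, t <= A i k & t <= B k j.
Proof.
by move=> t0; rewrite mxE => /(mmsum_ge t0)[k _ /mmmul_ge_split[]]; exists k.
Qed.

End Product.

Lemma mulmx_monor m p q (A : 'M[maxmin R]_(m, p))
    (B C : 'M[maxmin R]_(p, q)) i j :
  (forall k, B k j <= C k j) -> (A *m B) i j <= (A *m C) i j.
Proof.
move=> BC; apply: mulmx_le => k.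
by apply: (le_mulmx (k := k)); [apply: mmmul_lel | apply: mmmul_ler].
Qed.

End Sums.

(** * The Bellman equation x = M x + b *)

Lemma nuniq_loop (T : eqType) (x : T) (s : seq T) :
  ~~ uniq (x :: s) ->
  exists s1 s2 s3,
    [/\ s = s1 ++ s2 ++ s3, s2 != [::] & last (last x s1) s2 = last x s1].
Proof.
elim: s x => // y s IHs x; rewrite [uniq _]/= negb_and negbK => /orP[|/IHs].
  case/path.splitP=> s2 s3; exists [::], (rcons s2 x), s3.
  by rewrite last_rcons -size_eq0 size_rcons.
by case=> s1 [s2 [s3 [-> s2N0 loop]]]; exists (y :: s1), s2, s3.
Qed.

Section Bellman.
Variables (R : realType) (m : nat) (M : 'M[maxmin R]_m) (lambda : maxmin R).
Implicit Types (x b v : 'cV[maxmin R]_m).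

Local Notation star := (mxstar M).
Local Notation star_l := (mxstar_scaled lambda M).

Lemma mxstarE : star = 1%:M + mxplus M.
Proof. by rewrite /mxstar big_ltn. Qed.

Lemma mul_mxstar : M *m star = mxplus M.
Proof.
rewrite -(mxplus_stable M (leqnSn m)) /mxstar mulmx_sumr big_add1 /=.
by apply: eq_bigr => k _; rewrite exprS.
Qed.

Lemma mxpow_le_star k i j : (M ^+ k) i j <= star i j.
Proof.
rewrite -(mxstar_stable M (leq_maxl m k)) summxE.
apply: (le_mmsum (fun k => (M ^+ k) i j)).
by rewrite mem_index_iota ltnS leq_maxr.
Qed.

Lemma mxpow_le_plus k i j : (M ^+ k.+1) i j <= mxplus M i j.
Proof.
rewrite -(mxplus_stable M (leq_maxl m k.+1)) summxE.
apply: (le_mmsum (fun k => (M ^+ k) i j)).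
by rewrite mem_index_iota !ltnS leq_maxr.
Qed.

(** Multiplying by [M] only changes the diagonal of [star], from [1] to that of
    [mxplus M]; the scaling of the columns by that diagonal hides the change. *)
Lemma mul_mxstar_scaled : M *m star_l = star_l.
Proof.
apply/matrixP => i j; transitivity (lambda * mxplus M j j * (M *m star) i j).
  rewrite !mxE big_distrr /=; apply: eq_bigr => k _.
  by rewrite mxE mulrCA.
rewrite mul_mxstar !mxE mxstarE !mxE.
case: eqP => [->|_]; last by rewrite add0r.
rewrite -!mulrA; congr (_ * _); rewrite mmmul_idPl // mmmul_idPl //.
by rewrite mmadd_gel ?mm_le1.
Qed.

Lemma mxstar_scaled_le i j : star_l i j <= lambda.
Proof. by rewrite mxE -mulrA mmmul_lel. Qed.

Lemma bellman_solution b v (x := star *m b + star_l *m v) : x = M *m x + b.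
Proof.
rewrite /x mulmxDr !mulmxA mul_mxstar mul_mxstar_scaled mxstarE mulmxDl mul1mx.
by rewrite -addrA addrC.
Qed.

Lemma bellman_iterate b x h :
  x = M *m x + b -> x = (\sum_(0 <= k < h) M ^+ k) *m b + M ^+ h *m x.
Proof.
move=> eq_x; elim: h => [|h IHh].
  by rewrite big_nil mul0mx add0r expr0 mul1mx.
rewrite {1}IHh big_nat_recr //= mulmxDl exprSr -mulmxA {1}eq_x mulmxDr.
by rewrite -addrA; congr (_ + _); rewrite addrC.
Qed.

Lemma mxpow_subfixed x k :
  (forall i, (M *m x) i 0 <= x i 0) -> forall i, (M ^+ k *m x) i 0 <= x i 0.
Proof.
move=> Mx; elim: k => [|k IHk] i; first by rewrite expr0 mul1mx.
rewrite exprSr -mulmxA; apply: le_trans (IHk i).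
exact: mulmx_monor.
Qed.

(** A walk of length [m] on [m] nodes closes a cycle. If a weight [t] survives
    along the walk and in [x] at its end, it survives along the cycle, so a node
    [k] of the cycle gives a column [k] of [star_l] and an entry [x k] that are
    both at least [t]. *)
Lemma mxpow_le_star_scaled x i :
    (forall i, (M *m x) i 0 <= x i 0) -> (forall i, x i 0 <= lambda) ->
  (M ^+ m *m x) i 0 <= (star_l *m x) i 0.
Proof.
move=> Mx x_le; set t := (M ^+ m *m x) i 0.
have [t0|] := ltP (0 : maxmin R) t; last first.
  by move=> z; rewrite (le_trans z) ?mm_ge0.
have [j tMij txj] := mulmx_ge t0 (lexx t).
have [/(_ tMij)[p [path_p last_p size_p]] _] := mxpow_path M m i j t0.
have: ~~ uniq (i :: p).
  apply/negP => uniq_p; have := max_card (mem (i :: p)).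
  by rewrite card_ord (card_uniqP uniq_p) /= size_p ltnn.
case/nuniq_loop=> p1 [p2 [p3 [def_p p2N0 loop]]]; set k := last i p1 in loop.
move: path_p last_p; rewrite def_p !cat_path !last_cat -/k loop.
case/and3P=> path1 path2 path3 last3.
have tik : t <= mxstar M i k.
  apply: le_trans (mxpow_le_star (size p1) i k).
  by apply: (proj2 (mxpow_path M _ _ _ t0)); exists p1.
have tkk : t <= mxplus M k k.
  apply: le_trans (mxpow_le_plus (size p2).-1 k k).
  rewrite prednK ?lt0n ?size_eq0 //.
  by apply: (proj2 (mxpow_path M _ _ _ t0)); exists p2.
have txk : t <= x k 0.
  apply: le_trans (mxpow_subfixed (size p3) Mx k); apply: le_mulmx txj.
  by apply: (proj2 (mxpow_path M _ _ _ t0)); exists p3.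
apply: le_mulmx txk; rewrite mxE; do 2?apply: mmmul_ge => //.
exact: le_trans txj (x_le j).
Qed.

Lemma mxstar_mul_le x i :
  (forall i, (M *m x) i 0 <= x i 0) -> (star *m x) i 0 <= x i 0.
Proof.
move=> Mx; rewrite mulmx_suml summxE; apply: mmsum_le => k _.
exact: mxpow_subfixed.
Qed.

(** After [m + 1] iterations the inhomogeneous part has become [star *m b], and
    the remainder is absorbed by [star_l *m x], which itself never exceeds [x].
    Hence a solution is its own parameter in [bellman_solution]. *)
Lemma bellman_decomposition b x :
    x = M *m x + b -> (forall i, x i 0 <= lambda) ->
  x = star *m b + star_l *m x.
Proof.
move=> eq_x x_le.
have eq_xi i : x i 0 = (M *m x) i 0 + b i 0 by rewrite {1}eq_x mxE.
have Mx i : (M *m x) i 0 <= x i 0 by rewrite [leRHS]eq_xi mmadd_gel.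
have star_l_le i : (star_l *m x) i 0 <= x i 0.
  apply: le_trans (mxstar_mul_le i Mx); apply: mulmx_le => k.
  apply: (le_mulmx (k := k)); last exact: mmmul_ler.
  by apply: mmmul_lel; rewrite mxE mmmul_ler.
have eq_xm : x = star *m b + M ^+ m.+1 *m x by apply: bellman_iterate.
apply/matrixP => i j; rewrite (ord1 j); apply: le_anti; apply/andP; split.
  rewrite [leLHS](congr1 (fun y : 'cV_m => y i 0) eq_xm) mxE [leRHS]mxE.
  apply: mmadd_le; first exact: mmadd_gel.
  apply: mmadd_ger; rewrite exprSr -mulmxA.
  by apply: le_trans (mxpow_le_star_scaled i Mx x_le); apply: mulmx_monor.
rewrite [leLHS]mxE; apply: mmadd_le => //.
by rewrite [leRHS](congr1 (fun y : 'cV_m => y i 0) eq_xm) [leRHS]mxE mmadd_gel.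
Qed.

End Bellman.

(** * The equation lambda c + B z = lambda *)

Lemma scaled_onesE (R : realType) m (c : maxmin R) i j :
  (c *: (ones : 'cV_m)) i j = c.
Proof. by rewrite !mxE mulr1. Qed.

(** No term of [B z] exceeds [lambda], so a row is solved exactly when one term
    attains [lambda], or when [c] already does. *)
Lemma scaled_equation_covering (R : realType) p q (B : 'M[maxmin R]_(p, q))
    (lambda : maxmin R) (c : 'cV_p) (z : 'cV_q) :
    (forall i j, B i j <= lambda) ->
  lambda *: c + B *m z = lambda *: ones <->
  forall i, c i 0 < lambda -> exists2 j, lambda <= z j 0 & B i j = lambda.
Proof.
move=> B_le; split=> [eqz i ci | cover].
  have : (lambda *: c + B *m z) i 0 = lambda by rewrite eqz scaled_onesE.
  rewrite mxE mxE mmmul_idPr ?(ltW ci) // mmaddE => eqi.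
  have : lambda <= (B *m z) i 0 by rewrite leNgt; apply: contraPN eqi => Bz;
    apply/eqP; rewrite lt_eqF // gt_max ci.
  case/(mulmx_ge (le_lt_trans (mm_ge0 _) ci)) => j lamB lamz; exists j => //.
  by apply: le_anti; rewrite B_le.
apply/matrixP => i j; rewrite (ord1 j) scaled_onesE mxE mxE.
have Bz_le : (B *m z) i 0 <= lambda.
  by apply: mulmx_le => k; apply: mmmul_lel.
apply: le_anti; rewrite mmadd_le ?mmmul_lel //=.
have [/cover[k lamz Bik]|lamc] := ltP (c i 0) lambda.
  by apply: mmadd_ger; apply: le_mulmx lamz; rewrite Bik.
by rewrite mmmul_idPl // mmadd_gel.
Qed.

(** * Subvectors and blocks *)

Section Blocks.
Variables (R : realType) (n : nat).
Implicit Types (A : 'M[maxmin R]_n) (x : 'cV[maxmin R]_n) (P Q S : {set 'I_n}).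

Lemma enum_val_ex P i : i \in P -> exists k : 'I_#|P|, enum_val k = i.
Proof. by move=> iP; exists (enum_rank_in iP i); rewrite enum_rankK_in. Qed.

Lemma sum_enum_val P (v : 'cV[maxmin R]_#|P|) k :
  \sum_(j < #|P| | enum_val j == enum_val k) v j 0 = v k 0.
Proof. by rewrite (big_pred1 k) // => j; rewrite (inj_eq enum_val_inj). Qed.

Lemma sum_enum_val_out P (v : 'cV[maxmin R]_#|P|) i :
  i \notin P -> \sum_(j < #|P| | enum_val j == i) v j 0 = 0.
Proof.
move=> iP; rewrite big_pred0 // => j; apply: contraNF iP => /eqP <-.
exact: enum_valP.
Qed.

Lemma exists_subvec P Q (xP : 'cV[maxmin R]_#|P|) (xQ : 'cV[maxmin R]_#|Q|) :
  P :&: Q = set0 -> exists x, subvec x P = xP /\ subvec x Q = xQ.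
Proof.
move=> PQ0; exists (\col_i (\sum_(j < #|P| | enum_val j == i) xP j 0
                            + \sum_(j < #|Q| | enum_val j == i) xQ j 0)).
have notPQ i : i \in P -> i \in Q -> False.
  by move=> iP iQ; have := in_set0 i; rewrite -PQ0 inE iP iQ.
split; apply/matrixP => k j; rewrite (ord1 j) !mxE sum_enum_val.
  rewrite sum_enum_val_out ?addr0 //; apply/negP.
  exact: notPQ (enum_valP k).
rewrite sum_enum_val_out ?add0r //; apply/negP => kP.
exact: notPQ kP (enum_valP k).
Qed.

(** Block products are read back as sums over the original indices, where the
    index sets of the statement live. *)
Lemma mul_submat_subvec A P Q x i :
  (submat A P Q *m subvec x Q) i 0 =
  \sum_(j in Q) A (enum_val i) j * x j 0.
Proof.
by rewrite mxE [RHS]big_enum_val; apply: eq_bigr => k _; rewrite !mxE.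
Qed.

Lemma mul_submat_extend0 A P Q S (v : 'cV[maxmin R]_#|Q|) :
  Q \subset P -> submat A S P *m extend0 P v = submat A S Q *m v.
Proof.
move=> QP; apply/matrixP => i j0; rewrite (ord1 j0) !mxE.
under eq_bigr => l _ do rewrite !mxE big_distrr /=.
rewrite (exchange_big_dep predT) //=; apply: eq_bigr => j _.
have [l0 l0j] := enum_val_ex (subsetP QP _ (enum_valP j)).
rewrite (big_pred1 l0) => [|l]; first by rewrite mxE l0j.
by rewrite -l0j (inj_eq enum_val_inj) eq_sym.
Qed.

Lemma subvec_truncate x c P Q :
    (forall i, i \in P -> c <= x i 0) ->
    (forall i, i \in P -> i \notin Q -> x i 0 <= c) ->
  subvec x P = c *: ones + extend0 P (subvec x Q).
Proof.
move=> c_le le_c; apply/matrixP => k j; rewrite (ord1 j) !mxE mulr1.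
have kP := enum_valP k; have [kQ|kQ] := boolP (enum_val k \in Q).
  have [l El] := enum_val_ex kQ.
  by rewrite -El sum_enum_val mxE mmadd_idPr // El c_le.
rewrite sum_enum_val_out // addr0; apply: le_anti.
by rewrite c_le // le_c.
Qed.

End Blocks.

(** * The blocks of a (K,L)-eigenvector *)

Section KLBlocks.
Variables (R : realType) (n : nat) (A : 'M[maxmin R]_n) (lambda : maxmin R).
Variables K L : {set 'I_n}.
Hypotheses (hU : K :|: L = [set: 'I_n]) (hI : K :&: L = set0).
Implicit Type x : 'cV[maxmin R]_n.

Local Notation L2 := (idxL2 A lambda L).
Local Notation Lt := (idxLt A lambda K L).
Local Notation star := (mxstar (submat A K K)).
Local Notation star_l := (mxstar_scaled lambda (submat A K K)).
Local Notation c2 := (submat A L2 K *m star *m submat A K L *m ones).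
Local Notation B2 := (mxA' A lambda K L).

(** The candidate component on [K]; it belongs to an eigenvector when it also
    satisfies the rows in [L2]. *)
Definition x_KL (vL : 'cV[maxmin R]_#|Lt|) (vK : 'cV[maxmin R]_#|K|) :=
  lambda *: (star *m submat A K L *m ones) + star *m submat A K Lt *m vL
  + star_l *m vK.

Lemma sum_split_KL (F : 'I_n -> maxmin R) :
  \sum_j F j = \sum_(j in K) F j + \sum_(j in L) F j.
Proof.
rewrite (bigID (mem K)) /=; congr (_ + _); apply: eq_bigl => j.
have := in_setT j; have := in_set0 j; rewrite -hU -hI !inE.
by case: (j \in K); case: (j \in L).
Qed.

Lemma Lt_sub : Lt \subset L.
Proof. exact: subsetDl. Qed.

(** Pruning the columns of [idxLgtK] is what keeps the component on [K] below
    [lambda]. *)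
Lemma star_KLt_le k l : (star *m submat A K Lt) k l <= lambda.
Proof.
have := enum_valP l; rewrite inE => /andP[ltP lL].
have [l' El] := enum_val_ex lL.
have -> : (star *m submat A K Lt) k l = (star *m submat A K L) k l'.
  by rewrite !mxE; apply: eq_bigr => j _; rewrite !mxE El.
rewrite leNgt; apply: contra ltP => gt_k; rewrite inE -El imset_f ?orbT // inE.
apply: lt_le_trans gt_k _.
exact: (le_mmsum_cond (fun k => (star *m submat A K L) k l')).
Qed.

Lemma x_KL_le vL vK k : x_KL vL vK k 0 <= lambda.
Proof.
rewrite /x_KL mxE mxE; apply: mmadd_le; first apply: mmadd_le.
- by rewrite mxE mmmul_lel.
- by apply: mulmx_le => l; apply: mmmul_lel; apply: star_KLt_le.
- by apply: mulmx_le => l; apply: mmmul_lel; apply: mxstar_scaled_le.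
Qed.

(** This is the general solution of the Bellman equation on [K] whose constant
    term comes from [x_L = lambda + vL]. *)
Lemma x_KLE vL vK :
  x_KL vL vK =
  star *m (submat A K L *m (lambda *: ones + extend0 L vL)) + star_l *m vK.
Proof.
rewrite mulmxDr mul_submat_extend0 ?Lt_sub // mulmxDr -!scalemxAr.
by rewrite !mulmxA.
Qed.

Lemma KL_eigenvector_blocks x :
  KL_eigenvector A lambda K L x <->
  [/\ forall i, i \in K -> x i 0 <= lambda,
      forall i, i \in L -> lambda <= x i 0,
      subvec x K = submat A K K *m subvec x K + submat A K L *m subvec x L
    & forall i, i \in L ->
        \sum_(j in K) A i j * x j 0 + \sum_(j in L) A i j * x j 0 = lambda].
Proof.
have row i : (A *m x) i 0 =
    \sum_(j in K) A i j * x j 0 + \sum_(j in L) A i j * x j 0.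
  by rewrite mxE sum_split_KL.
split=> [[eig x_le le_x]|[x_le le_x eqK eqL]]; split=> //.
- apply/matrixP => k j; rewrite (ord1 j) [RHS]mxE !mul_submat_subvec -row eig.
  by rewrite !mxE mmmul_idPr ?x_le ?enum_valP.
- by move=> i iL; rewrite -row eig mxE mmmul_idPl ?le_x.
apply/matrixP => i j; rewrite (ord1 j) row [RHS]mxE.
have := in_setT i; rewrite -hU inE => /orP[iK|iL]; last first.
  by rewrite eqL // mmmul_idPl ?le_x.
rewrite mmmul_idPr ?x_le //; have [k <-] := enum_val_ex iK.
rewrite -!mul_submat_subvec.
have : subvec x K k 0 =
    (submat A K K *m subvec x K + submat A K L *m subvec x L) k 0.
  by rewrite {1}eqK.
by rewrite [RHS]mxE [LHS]mxE.
Qed.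

(** A column [k] with an entry above [lambda] in a row of [L1] would push that
    row above [lambda] if [x k] did. With these columns capped, the part in [L]
    of a row equals [lambda] on [L1], and is below [lambda] on [L2], where [K]
    has to supply the missing value. *)
Lemma rows_L_equiv x :
    (forall i, i \in K -> x i 0 <= lambda) ->
    (forall i, i \in L -> lambda <= x i 0) ->
  (forall i, i \in L ->
     \sum_(j in K) A i j * x j 0 + \sum_(j in L) A i j * x j 0 = lambda) <->
  (forall k, k \in idxLgtL1 A lambda L -> x k 0 <= lambda) /\
  submat A L2 K *m subvec x K = lambda *: ones.
Proof.
move=> x_le le_x.
have sumK_le i : \sum_(j in K) A i j * x j 0 <= lambda.
  by apply: mmsum_cond_le => j jK; rewrite mmmul_ler ?x_le.
split=> [eqL | [x_le_bad eq2] i iL].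
  split=> [k|].
    rewrite inE => /andP[kL /mmsum_cond_gt[i]]; rewrite inE => /andP[iL _] lt_A.
    have : A i k * x k 0 <= lambda.
      rewrite -(eqL i iL) mmadd_ger //.
      exact: (le_mmsum_cond (fun k => A i k * x k 0)).
    by rewrite mmmulE ge_min leNgt lt_A.
  apply/matrixP => k j; rewrite (ord1 j) scaled_onesE mul_submat_subvec.
  have := enum_valP k; rewrite inE => /andP[iL lt_l].
  have lt_s : \sum_(j in L) A (enum_val k) j * x j 0 < lambda.
    by apply: le_lt_trans lt_l; apply: mmsum_cond_mono => l _; apply: mmmul_lel.
  have := eqL _ iL; rewrite mmaddE => eq_l; apply: le_anti; rewrite sumK_le /=.
  by rewrite leNgt; apply/negP => lt_k; move: (lexx lambda);
    rewrite -{2}eq_l leNgt gt_max lt_k lt_s.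
have [lt_l|ge_l] := ltP (\sum_(j in L) A i j) lambda.
  have iL2 : i \in L2 by rewrite inE iL.
  have [k Ek] := enum_val_ex iL2.
  have := mul_submat_subvec A K x k; rewrite eq2 scaled_onesE Ek => <-.
  rewrite addrC; apply: mmadd_idPr; apply: le_trans (ltW lt_l).
  by apply: mmsum_cond_mono => l _; apply: mmmul_lel.
suff sumL : \sum_(j in L) A i j * x j 0 = lambda.
  by rewrite sumL mmadd_idPr.
apply: le_anti; apply/andP; split.
  apply: mmsum_cond_le => j jL; have [le_A|lt_A] := leP (A i j) lambda.
    exact: mmmul_lel.
  apply: mmmul_ler; apply: x_le_bad; rewrite inE jL /=.
  apply: lt_le_trans lt_A _; apply: (le_mmsum_cond (fun i => A i j)).
  by rewrite inE iL.
have <- : (\sum_(j in L) A i j) * lambda = lambda by rewrite mmmul_idPr.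
rewrite big_distrl /=; apply: mmsum_cond_mono => j jL.
by apply: mmmul_ge; [apply: mmmul_lel | apply: mmmul_ler; apply: le_x].
Qed.

(** A column [l] of [idxLgtK] has [x l <= lambda], since an entry above [lambda]
    of [star *m A_KL] would carry a larger [x l] into [x_K]. *)
Lemma KL_eigenvector_decomposition x :
  KL_eigenvector A lambda K L x ->
  [/\ subvec x L = lambda *: ones + extend0 L (subvec x Lt),
      subvec x K = x_KL (subvec x Lt) (subvec x K)
    & submat A L2 K *m subvec x K = lambda *: ones].
Proof.
case/KL_eigenvector_blocks => x_le le_x eqK.
case/(rows_L_equiv x_le le_x) => x_bad eq2.
have xK_le k : subvec x K k 0 <= lambda by rewrite mxE x_le ?enum_valP.
have := bellman_decomposition eqK xK_le => eq_xK.
suff eq_xL : subvec x L = lambda *: ones + extend0 L (subvec x Lt).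
  by split=> //; rewrite x_KLE -eq_xL.
apply: subvec_truncate => // i iL; rewrite inE iL andbT negbK inE => /orP[].
  exact: x_bad.
case/imsetP=> l; rewrite inE => /mmsum_cond_gt[k _ lt_k] ->.
have : (star *m (submat A K L *m subvec x L)) k 0 <= lambda.
  by apply: le_trans (xK_le k); rewrite [in leRHS]eq_xK [leRHS]mxE mmadd_gel.
rewrite mulmxA => le_k; rewrite leNgt; apply/negP => lt_x.
suff : lambda < lambda by rewrite ltxx.
apply: lt_le_trans (le_k); rewrite mxE.
apply: lt_le_trans (le_mmsum_cond (i := l) _ _) => //.
by rewrite mmmulE lt_min lt_k mxE.
Qed.

(** The bound on [x_K] and the cap on [x_L] come from the definition of [Lt], the
    rows in [K] from [bellman_solution], and those in [L] from
    [rows_L_equiv]. *)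
Lemma KL_eigenvector_of_decomposition x vL vK :
    subvec x L = lambda *: ones + extend0 L vL -> subvec x K = x_KL vL vK ->
    submat A L2 K *m x_KL vL vK = lambda *: ones ->
  KL_eigenvector A lambda K L x.
Proof.
move=> eq_xL eq_xK eq2.
have x_le i : i \in K -> x i 0 <= lambda.
  case/(enum_val_ex (P := K)) => k <-; have := x_KL_le vL vK k.
  by rewrite -eq_xK mxE.
have xLE (l : 'I_#|L|) : x (enum_val l) 0 =
    lambda + \sum_(j < #|Lt| | enum_val j == enum_val l) vL j 0.
  have : subvec x L l 0 = (lambda *: ones + extend0 L vL) l 0 by rewrite eq_xL.
  by rewrite !mxE mulr1.
have le_x i : i \in L -> lambda <= x i 0.
  by case/(enum_val_ex (P := L)) => l <-; rewrite xLE mmadd_gel.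
apply/KL_eigenvector_blocks; split=> //.
  by rewrite eq_xK eq_xL x_KLE; apply: bellman_solution.
apply/rows_L_equiv => //; split=> [i iL1|]; last by rewrite eq_xK.
have iL : i \in L by move: iL1; rewrite inE => /andP[].
have [l El] := enum_val_ex iL.
have iLt : i \notin Lt by rewrite inE inE iL1.
by rewrite -El xLE sum_enum_val_out ?addr0 // El.
Qed.

(** * Coverings *)

Lemma mxA'_le i j : B2 i j <= lambda.
Proof.
rewrite /mxA' -[j]splitK; case: (split j) => [l|k] /=.
  rewrite row_mxEl -mulmxA; apply: mulmx_le => l'; apply: mmmul_ler.
  exact: star_KLt_le.
rewrite row_mxEr; apply: mulmx_le => l'; apply: mmmul_ler.
exact: mxstar_scaled_le.
Qed.

Lemma mul_L2_x_KL vL vK :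
  submat A L2 K *m x_KL vL vK = lambda *: c2 + B2 *m col_mx vL vK.
Proof.
by rewrite mul_row_col !mulmxDr -scalemxAr !mulmxA addrA.
Qed.

Lemma coveringP (W : {set 'I_(#|Lt| + #|K|)}) :
  covering A lambda K L W <->
  forall i, c2 i 0 < lambda -> exists2 j, j \in W & B2 i j = lambda.
Proof.
split=> [cov i ci | cov].
  have : i \in idxI0 A lambda K L by rewrite inE.
  by rewrite -cov => /bigcupP[j jW]; rewrite inE => /andP[_ /eqP]; exists j.
apply/eqP; rewrite eqEsubset; apply/andP; split; apply/subsetP => i.
  by case/bigcupP=> j _; rewrite inE => /andP[].
move=> iI0; have := iI0; rewrite inE => /cov[j jW Bij].
by apply/bigcupP; exists j => //; rewrite inE iI0 Bij eqxx.
Qed.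

Lemma covering_setT :
  covering A lambda K L setT <->
  idxI0 A lambda K L = \bigcup_j cover_set A lambda K L j.
Proof.
by rewrite /covering (eq_bigl xpredT) => [|j]; rewrite ?inE //; split=> ->.
Qed.

Lemma solution_covering z :
  lambda *: c2 + B2 *m z = lambda *: ones <->
  covering A lambda K L [set j | lambda <= z j 0].
Proof.
split=> [/(scaled_equation_covering _ _ mxA'_le) sol|/coveringP cov].
  by apply/coveringP => i /sol[j lez Bij]; exists j; rewrite ?inE.
apply/(scaled_equation_covering _ _ mxA'_le) => i /cov[j].
by rewrite inE; exists j.
Qed.

(** A row [i] of [idxI0] reaches [L] through [K] with a weight below [lambda],
    hence its subset [Lt] as well, so only columns from [K] can cover it. *)
Lemma mxA'_Lt_lt i l : c2 i 0 < lambda -> B2 i (lshift #|K| l) < lambda.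
Proof.
apply: le_lt_trans; rewrite row_mxEl.
have [l' El] := enum_val_ex (subsetP Lt_sub _ (enum_valP l)).
apply: (le_mulmx (k := l')); last by rewrite [leRHS]mxE mm_le1.
suff -> : (submat A L2 K *m star *m submat A K Lt) i l
        = (submat A L2 K *m star *m submat A K L) i l' by [].
by rewrite !mxE; apply: eq_bigr => k _; congr (_ * _); rewrite !mxE El.
Qed.

(** Any covering solves the equation through its part in [K] alone, as its
    columns from [Lt] cover nothing. *)
Lemma covering_zW_K W vL vK :
  covering A lambda K L W ->
  submat A L2 K *m x_KL vL (zW_K A lambda K L W + vK) = lambda *: ones.
Proof.
move=> /coveringP cov; rewrite mul_L2_x_KL.
apply/(scaled_equation_covering _ _ mxA'_le) => i ci.
have [j jW Bij] := cov i ci; exists j => //; move: jW Bij.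
rewrite -[j]splitK; case: (split j) => [l|k] /= jW Bij.
  by have := mxA'_Lt_lt l ci; rewrite Bij ltxx.
by rewrite col_mxEd !mxE jW mmadd_gel.
Qed.

Lemma covering_minimal W :
  covering A lambda K L W ->
  exists2 V : {set _}, V \subset W & minimal_covering A lambda K L V.
Proof.
move/eqP/(@minset_exists _ (fun V : {set 'I_(#|Lt| + #|K|)} =>
  \bigcup_(j in V) cover_set A lambda K L j == idxI0 A lambda K L)).
case=> V /minsetP[/eqP covV minV] VW; exists V => //; split=> // U UV /eqP covU.
by have := UV; rewrite (minV U covU (proper_sub UV)) properxx.
Qed.

Lemma zW_K_absorbed (W : {set 'I_(#|Lt| + #|K|)}) (vL : 'cV_#|Lt|) vK :
  W \subset [set j | lambda <= (col_mx vL vK) j 0] ->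
  zW_K A lambda K L W + vK = vK.
Proof.
move=> /subsetP WS; apply/matrixP => k j; rewrite (ord1 j) [LHS]mxE.
apply: mmadd_idPr; rewrite !mxE; case: ifP => [/WS|_]; last exact: mm_ge0.
by rewrite inE col_mxEd.
Qed.

End KLBlocks.

Theorem theorem3p1 (R : realType) (n : nat) (A : 'M[maxmin R]_n)
    (lambda : maxmin R) (K L : {set 'I_n})
    (hU : K :|: L = [set: 'I_n]) (hI : K :&: L = set0) :
  let L2 := idxL2 A lambda L in
  let Lt := idxLt A lambda K L in
  let star := mxstar (submat A K K) in
  let star_l := mxstar_scaled lambda (submat A K K) in
  [<-> exists x : 'cV[maxmin R]_n, KL_eigenvector A lambda K L x;
       exists (zL : 'cV[maxmin R]_#|Lt|) (zK : 'cV[maxmin R]_#|K|),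
         lambda *: (submat A L2 K *m star *m submat A K L *m ones)
         + submat A L2 K *m star *m submat A K Lt *m zL
         + submat A L2 K *m star_l *m zK = lambda *: ones;
       idxI0 A lambda K L = \bigcup_j cover_set A lambda K L j]
  /\
  ((exists x : 'cV[maxmin R]_n, KL_eigenvector A lambda K L x) ->
   forall x : 'cV[maxmin R]_n,
     KL_eigenvector A lambda K L x <->
     exists (vK : 'cV[maxmin R]_#|K|) (vL : 'cV[maxmin R]_#|Lt|)
            (W : {set 'I_(#|Lt| + #|K|)}),
       [/\ minimal_covering A lambda K L W,
           subvec x L = lambda *: ones + extend0 L vL
         & subvec x K = lambda *: (star *m submat A K L *m ones)
                        + star *m submat A K Lt *m vL
                        + star_l *m (zW_K A lambda K L W + vK)]).
Proof.
move=> L2 Lt star star_l.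
have rowsE zL zK :
    lambda *: (submat A L2 K *m star *m submat A K L *m ones)
    + submat A L2 K *m star *m submat A K Lt *m zL
    + submat A L2 K *m star_l *m zK
  = submat A L2 K *m x_KL zL zK.
  by rewrite mul_L2_x_KL mul_row_col addrA.
split; first tfae.
- case=> x /(KL_eigenvector_decomposition hU hI)[_ eq_xK eq2].
  by exists (subvec x Lt), (subvec x K); rewrite rowsE -eq_xK.
- case=> zL [zK]; rewrite rowsE mul_L2_x_KL => /solution_covering/coveringP cov.
  by apply/covering_setT/coveringP => i /cov[j _]; exists j.
- move/covering_setT => covT.
  pose zL : 'cV[maxmin R]_#|Lt| := const_mx lambda.
  pose zK : 'cV[maxmin R]_#|K| := const_mx lambda.
  have eq2 : submat A L2 K *m x_KL zL zK = lambda *: ones.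
    rewrite mul_L2_x_KL; apply/solution_covering.
    rewrite (_ : [set j | _] = setT) //; apply/setP => j.
    by rewrite !inE col_mx_const mxE lexx.
  have [x [eq_xK eq_xL]] :=
    exists_subvec (x_KL zL zK) (lambda *: ones + extend0 L zL) hI.
  by exists x; apply: (KL_eigenvector_of_decomposition hU hI eq_xL eq_xK).
move=> _ x; split=> [eig | [vK [vL [W [[cov _] eq_xL eq_xK]]]]].
  have [eq_xL eq_xK eq2] := KL_eigenvector_decomposition hU hI eig.
  move: eq2; rewrite eq_xK mul_L2_x_KL.
  case/solution_covering/covering_minimal=> W sW minW.
  exists (subvec x K), (subvec x Lt), W; split=> //.
  by rewrite (zW_K_absorbed sW).
apply: (KL_eigenvector_of_decomposition hU hI eq_xL eq_xK).
exact: covering_zW_K.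
Qed.
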